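(* Let $X$ be a two-dimensional strictly convex real Banach space. Let $A$ be a nontrivial bounded subset of $X$ containing its Chebyshev center $c_A$. Then $A$ is CCNF.
   Context: A Banach space $X$ is strictly convex if its unit sphere contains no nontrivial line segment. For a nonempty bounded set $A \subseteq X$ and $x \in X$, put $r(x,A) = \sup_{a \in A}\|x-a\|$ and $F(x,A) = \{a \in A : \|x-a\| = r(x,A)\}$, and let $\mathrm{Far}\,A = \bigcup_{x \in X} F(x,A)$. The Chebyshev radius of $A$ is $r(A) = \inf_{x \in X} r(x,A)$; a point $c \in X$ with $r(c,A) = r(A)$ is called a Chebyshev center of $A$. (In uniformly convex spaces, in particular in finite-dimensional strictly convex spaces, every nonempty bounded set has a unique Chebyshev center.) A set is nontrivial if it has at least two elements. $A$ is a CCF set if some Chebyshev center of $A$ belongs to $\mathrm{Far}\,A$, and a CCNF set otherwise. *)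

(* Defs.v *)
From HB Require Import structures.
From mathcomp Require Import all_boot all_order all_algebra.
From mathcomp Require Import all_classical all_reals all_analysis.
Set Implicit Arguments.
Unset Strict Implicit.
Unset Printing Implicit Defensive.
Import Order.TTheory GRing.Theory Num.Theory numFieldNormedType.Exports.
Local Open Scope classical_set_scope.
Local Open Scope ring_scope.

(* The norm is an arbitrary one: it need not be related to the coordinates
   provided by the vector space structure. *)
#[short(type="finBanachType")]
HB.structure Definition FinBanach (R : numFieldType) :=
  {X of CompleteNormedModule R X & Vector R X}.

Section Definitions.
Context {R : realType} {X : normedModType R}.
Implicit Types (A : set X) (x y c : X).

Definition segment x y : set X :=
  [set (1 - t) *: x + t *: y | t in `[0%R, 1%R]].

Definition unit_sphere : set X := [set x | `|x| = 1].

Definition nontrivial A : Prop := exists x y, [/\ A x, A y & x <> y].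

(* As [sup] and [inf] are real valued, [far_radius] and [chebyshev_radius]
   have their usual meaning only when A is nonempty and bounded. *)
Definition far_radius x A : R := sup [set `|x - a| | a in A].

Definition farthest x A : set X := [set a | A a /\ `|x - a| = far_radius x A].

Definition Far A : set X := \bigcup_x farthest x A.

Definition chebyshev_radius A : R := inf [set far_radius x A | x in setT].

Definition chebyshev_center A c : Prop := far_radius c A = chebyshev_radius A.

Definition CCF A : Prop := exists c, chebyshev_center A c /\ Far A c.

Definition CCNF A : Prop := ~ CCF A.

End Definitions.

Definition strictly_convex {R : realType} (X : normedModType R) : Prop :=
  forall x y : X, x <> y -> ~ (segment x y `<=` unit_sphere).

(* Main.v *)
Require Import Defs.
From HB Require Import structures.
From mathcomp Require Import all_boot all_order all_algebra.
From mathcomp Require Import all_classical all_reals all_analysis.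
From mathcomp Require Import ring lra.
Import Order.TTheory GRing.Theory Num.Theory numFieldNormedType.Exports.
Local Open Scope classical_set_scope.
Local Open Scope ring_scope.

(* Suppose that a Chebyshev center of A lies in Far A, hence in A; translate it
   to 0 and let r be the Chebyshev radius. Then A lies in the lens
   {a | |a| <= r, |x - a| <= |x|} for some x <> 0. Pick e <> 0 such that x is
   Birkhoff orthogonal to e, then v outside the line of e such that e is
   Birkhoff orthogonal to v. By strict convexity every nonzero point of the lens
   is strictly on the same side of the line of e as x, and moving such a point a
   towards its projection on this line along v, whose norm is at most |a|,
   brings it strictly inside the ball of radius r. By compactness the lens is
   contained in a ball of radius < r centered at a small multiple of v, which
   contradicts the minimality of r. *)

(** The point at [t] is a convex combination of [x] and the point at [u], the latter with weight
    [t / u > 0], so a norm below [r] at [u] would force one at [t]. *)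
Lemma convex_norm_max {R : realType} {X : normedModType R} (r t u : R)
    (x y : X) :
  `|x| <= r -> `|y| <= r -> 0 < t -> t < 1 -> t <= u -> u <= 1 ->
  r <= `|(1 - t) *: x + t *: y| -> r <= `|(1 - u) *: x + u *: y|.
Proof.
move=> xr yr t0 t1 tu u1 rt.
have u0 : 0 < u by lra.
have E : u *: ((1 - t) *: x + t *: y) =
    (u - t) *: x + t *: ((1 - u) *: x + u *: y).
  rewrite !scalerDr !scalerA addrA -scalerDl.
  by congr (_ *: _ + _ *: _); ring.
have := congr1 (fun z => `|z|) E.
rewrite /= normrZ gtr0_norm // => {}E.
have := ler_normD ((u - t) *: x) (t *: ((1 - u) *: x + u *: y)).
rewrite -E !normrZ ger0_norm ?subr_ge0 // (gtr0_norm t0) => H.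
have H1 : u * r <= u * `|(1 - t) *: x + t *: y| by rewrite ler_pM2l.
have H2 : (u - t) * `|x| <= (u - t) * r by rewrite ler_wpM2l ?subr_ge0.
by rewrite -(ler_pM2l t0); lra.
Qed.

(** If the norm reached [r] at one interior point, it would equal [r] along the whole segment, which
    rescales into the unit sphere. *)
Lemma strictly_convex_norm_lt {R : realType} {X : normedModType R} (r t : R)
    (x y : X) :
  strictly_convex X -> x <> y -> `|x| <= r -> `|y| <= r -> 0 < t -> t < 1 ->
  `|(1 - t) *: x + t *: y| < r.
Proof.
move=> scX xy xr yr t0 t1; rewrite ltNge; apply/negP => rt.
have r0 : 0 < r.
  rewrite lt_neqAle (le_trans _ xr) // andbT; apply/eqP => r0; apply: xy.
  by move: xr yr; rewrite -r0 !normr_le0 => /eqP -> /eqP ->.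
apply: (scX (r^-1 *: x) (r^-1 *: y)).
  by move/(scalerI (invr_neq0 (lt0r_neq0 r0))).
move=> _ [u /= u01 <-]; rewrite in_itv /= in u01; case/andP: u01 => u0 u1.
rewrite /unit_sphere /=.
have -> : (1 - u) *: (r^-1 *: x) + u *: (r^-1 *: y) =
    r^-1 *: ((1 - u) *: x + u *: y).
  by rewrite scalerDr !scalerA; congr (_ *: _ + _ *: _); ring.
rewrite normrZ gtr0_norm ?invr_gt0 //.
suff -> : `|(1 - u) *: x + u *: y| = r by rewrite mulVf // gt_eqF.
apply/le_anti/andP; split.
  apply: le_trans (ler_normD _ _) _; rewrite !normrZ !ger0_norm ?subr_ge0 //.
  have : u * `|y| <= u * r by rewrite ler_wpM2l.
  have : (1 - u) * `|x| <= (1 - u) * r by rewrite ler_wpM2l ?subr_ge0.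
  lra.
(* Parameters below [t] are handled by exchanging the endpoints. *)
have [tu|ut] := leP t u; first exact: convex_norm_max rt.
have := @convex_norm_max _ _ r (1 - t) (1 - u) y x yr xr.
rewrite !subKr [t *: y + _]addrC [u *: y + _]addrC.
by apply => //; lra.
Qed.

(* One step of the Hahn-Banach extension: [s] is determined by the value at [y]
   of a functional of norm 1 that norms [x]. *)
Lemma birkhoff_orthogonal_exists {R : realType} {X : normedModType R}
    {x : X} (y : X) : x <> 0 ->
  exists s : R, forall a b : R, `|a| * `|x| <= `|a *: x + b *: (y + s *: x)|.
Proof.
move=> /eqP x0.
have nx0 : 0 < `|x| by rewrite normr_gt0.
(* The value [l] sought at [y] must lie above all elements of [S] and below all the bounds of [ubS].
   The triangle inequality separates the two families, so [sup S] works. *)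
pose S := [set a * `|x| - `|a *: x - y| | a in [set: R]].
have S0 : S !=set0 by exists (0 * `|x| - `|0 *: x - y|); exists 0.
have ubS b : ubound S (`|b *: x + y| - b * `|x|).
  move=> _ [a _ <-]; rewrite lerBrDr addrAC lerBlDr -mulrDl.
  have -> : `|b *: x + y| + `|a *: x - y| = `|a *: x - y| + `|b *: x + y|.
    exact: addrC.
  apply: le_trans (ler_normD _ _).
  by rewrite addrA -[_ - y + _]addrAC subrK -scalerDl normrZ ler_wpM2r ?ler_norm.
pose l := sup S.
have lub b : l <= `|b *: x + y| - b * `|x| by apply: ge_sup.
have llb a : a * `|x| - `|a *: x - y| <= l.
  by apply: ub_le_sup; [exists (`|0 *: x + y| - 0 * `|x|) | exists a].
have H a b : a * `|x| + b * l <= `|a *: x + b *: y|.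
  have [b0|b0|->] := ltgtP b 0.
  - have nb0 : 0 < - b by rewrite oppr_gt0.
    have ab : - b * (a / - b) = a by rewrite mulrC divfK // gt_eqF.
    have := llb (a / - b); rewrite -(ler_pM2l nb0) mulrBr [_ * (_ * `|x|)]mulrA.
    rewrite -[X in X * `|_ - _|](gtr0_norm nb0) -normrZ scalerBr scalerA !ab.
    by rewrite scaleNr opprK; lra.
  - have ab : b * (a / b) = a by rewrite mulrC divfK // gt_eqF.
    have := lub (a / b); rewrite -(ler_pM2l b0) mulrBr [_ * (_ * `|x|)]mulrA.
    rewrite -[X in X * `|_ + _|](gtr0_norm b0) -normrZ scalerDr scalerA !ab.
    lra.
  - by rewrite scale0r mul0r !addr0 normrZ ler_wpM2r ?ler_norm.
(* The functional is [|x|] at [x] and [l] at [y]; this [s] makes it vanish at [y + s *: x]. *)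
exists (- (l / `|x|)) => a b.
have -> : a *: x + b *: (y + - (l / `|x|) *: x) =
    (a - b * (l / `|x|)) *: x + b *: y.
  rewrite scalerDr scalerA scalerDl mulrN -addrA; congr (_ + _); exact: addrC.
have E c d : (c - d * (l / `|x|)) * `|x| + d * l = c * `|x|.
  by rewrite mulrBl -!mulrA mulVf ?gt_eqF // mulr1 subrK.
have [a0|a0] := leP 0 a.
- by rewrite ger0_norm // -(E a b).
(* [H] carries no absolute value, so for negative [a] it is applied to the opposite vector. *)
- rewrite ltr0_norm // -(E (- a) (- b)) -[leRHS]normrN opprD.
  rewrite -[- (_ *: x)]scaleNr -[- (b *: y)]scaleNr.
  by rewrite (_ : - (a - _) = - a - - b * (l / `|x|)); [exact: H|ring].
Qed.

Lemma dim2_basis {R : realType} {X : finBanachType R} {x : X} :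
  \dim {:X} = 2%N -> x <> 0 ->
  exists2 y : X, (forall a : R, y <> a *: x) &
  forall z : X, exists a b : R, z = a *: x + b *: y.
Proof.
move=> dimX /eqP x0.
have [y yx] : exists y : X, y \notin <[x]>%VS.
  apply: contrapT => /forallNP H.
  have : (fullv <= <[x]>)%VS.
    by apply/subvP => y _; apply/negPn/negP; exact: H.
  by move/dimvS; rewrite dimX dim_vline x0.
exists y.
  by move=> a E; move/negP: yx; apply; apply/vlineP; exists a.
move=> z.
have full : (<[x]> + <[y]>)%VS = fullv.
  apply/eqP; rewrite eqEdim subvf dimX dimv_disjoint_sum.
    rewrite !dim_vline x0; case: eqP => // y0.
    by rewrite y0 mem0v in yx.
  apply/eqP; rewrite -subv0; apply/subvP => w /[!memv_cap] /andP[].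
  move=> /vlineP[a ->] /vlineP[b]; have [->|b0] := eqVneq b 0.
    by rewrite scale0r => ->; rewrite mem0v.
  move=> E; case/negP: yx; apply/vlineP; exists (b^-1 * a).
  by rewrite -scalerA E scalerA mulVf // scale1r.
have : z \in (<[x]> + <[y]>)%VS by rewrite full memvf.
by case/memv_addP => _ /vlineP[a ->] [_ /vlineP[b ->]] ->; exists a, b.
Qed.

Lemma lens_translate {R : realType} {X : finBanachType R} {x : X} {r : R} :
  \dim {:X} = 2%N -> strictly_convex X -> x <> 0 -> 0 < r ->
  exists (v : X) (rho : R), rho < r /\
  forall a : X, `|a| <= r -> `|x - a| <= `|x| -> `|v - a| <= rho.
Proof.
move=> dimX scX x0 r0.
have [y yx span] := dim2_basis dimX x0.
have [s xe] := birkhoff_orthogonal_exists y x0.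
set e := y + s *: x in xe.
have e0 : e <> 0.
  by move/eqP; rewrite addr_eq0 -scaleNr => /eqP; exact: yx.
have [s' ev] := birkhoff_orthogonal_exists x e0.
set v := x + s' *: e in ev.
have ye : y = e - s *: x by rewrite /e addrK.
have vE : v = x + s' *: e by [].
clearbody v e.
have coord (a : X) : exists p : R * R, a = p.1 *: e + p.2 *: v.
  have [a1 [a2 ->]] := span a.
  exists (a2 - (a1 - a2 * s) * s', a1 - a2 * s) => /=.
  transitivity ((a1 - a2 * s) *: x + a2 *: e).
    by rewrite ye scalerBr scalerA scalerBl addrCA [LHS]addrC.
  rewrite vE scalerDr scalerA [(a2 - _) *: e]scalerBl [RHS]addrC -[RHS]addrA.
  by rewrite [X in _ = _ + X]addrC subrK.
pose f (p : R * R) : X := p.1 *: e + p.2 *: v.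
have fc : continuous f.
  move=> p; apply: cvgD; apply: cvgZr_tmp.
  - exact: cvg_fst.
  - exact: cvg_snd.
have nx0 : 0 < `|x| by rewrite normr_gt0; apply/eqP.
have ne0 : 0 < `|e| by rewrite normr_gt0; apply/eqP.
have xf p : x - f p = (1 - p.2) *: x + (- (p.1 + p.2 * s')) *: e.
  rewrite /f vE scalerDr scalerA scaleNr scalerBl scale1r scalerDl.
  by rewrite -[RHS]addrA -opprD; congr (_ - _); rewrite addrCA addrA.
(* Orthogonality of [x] to [e] gives [|1 - p.2| * |x| <= |x - f p|]. *)
have p2 p : `|x - f p| <= `|x| -> 0 <= p.2 /\ p.2 <= 2.
  move=> h; have := le_trans (xe (1 - p.2) (- (p.1 + p.2 * s'))).
  rewrite -xf => /(_ _ h); rewrite -[leRHS]mul1r ler_pM2r // ler_norml.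
  by case/andP; split; lra.
(* At height 0, if [x] and [x - f p] were distinct, their midpoint would have norm below [|x|],
   against the orthogonality of [x] to [e]. *)
have p2_eq0 p : `|x - f p| <= `|x| -> p.2 = 0 -> f p = 0.
  rewrite /f => + p20; rewrite p20 scale0r addr0 => h.
  apply: contrapT => fp0.
  have xy : x <> x - p.1 *: e.
    by move=> E; apply: fp0; rewrite -(subKr x (p.1 *: e)) -E subrr.
  have := @strictly_convex_norm_lt _ _ `|x| (2^-1) _ _ scX xy (lexx _) h.
  have -> : (1 - 2^-1) *: x + 2^-1 *: (x - p.1 *: e) =
     1 *: x + (- (2^-1 * p.1)) *: e :> X.
    rewrite scalerBr addrA -scalerDl subrK scalerA scaleNr //.
  have := xe 1 (- (2^-1 * p.1)); rewrite normr1 mul1r => h1 h2.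
  have : `|x| < `|x|.
    by apply: le_lt_trans h1 _; apply: h2; lra.
  by rewrite ltxx.
have distc (z : X) : continuous (fun p => `|z - f p|).
  move=> p; apply: cvg_norm; apply: cvgB; [exact: cvg_cst|exact: fc].
(* Orthogonality of [e] to [v] bounds [p.1] by [m]. Keeping only points of norm at least [r / 2]
   excludes 0, hence height 0. *)
pose m := r / `|e|.
pose D : set (R * R) := (`[- m, m] `*` `[0, 2]) `&`
   ((fun p => `|x - f p|) @^-1` [set u | u <= `|x|] `&`
    ((fun p => `|0 - f p|) @^-1` [set u | r / 2 <= u] `&`
     (fun p => `|0 - f p|) @^-1` [set u | u <= r])).
have Dc : compact D.
  apply: compact_closedI.
    by apply: compact_setX; exact: segment_compact.
  apply: closedI; [|apply: closedI]; apply: preimage_closed;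
    by [move=> p _; exact: distc | exact: closed_le | exact: closed_ge].
have DE p : D p -> [/\ `|x - f p| <= `|x|, r / 2 <= `|f p| & `|f p| <= r].
  by case=> _ /= [? []]; rewrite sub0r normrN.
have DP a : `|a| <= r -> `|x - a| <= `|x| -> r / 2 <= `|a| ->
    exists2 p, D p & a = f p.
  have [p ->] := coord a => ar xa ra; exists p => //; rewrite -/(f p) in ar xa ra.
  split; last by rewrite /= sub0r normrN.
  have [p20 p22] := p2 _ xa; split; last by rewrite /= in_itv /= p20.
  rewrite /= in_itv /= -ler_norml /m ler_pdivlMr //.
  exact: le_trans (ev _ _) ar.
(* The far points of the lens are at height [p.2 > 0], and the segment from
   [f p] down to [f p - p.2 *: v] lies in the open ball of radius [r] except
   for its endpoints, so a translation by less than all the heights works. *)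
have [t [t0 [tv tD]]] : exists t : R, 0 < t /\ `|t *: v| <= r / 4 /\
    forall p, D p -> t < p.2.
  (* Below this threshold, the lens points of norm less than [r / 2] stay within [3 / 4 * r] of
     [t *: v]. *)
  pose t0 := r / 4 / (`|v| + 1).
  have v1 : 0 < `|v| + 1 by apply: ltr_wpDl.
  have t0_gt0 : 0 < t0 by rewrite !divr_gt0.
  have t0v (t : R) : 0 < t -> t <= t0 -> `|t *: v| <= r / 4.
    move=> tgt0 tt0; rewrite normrZ gtr0_norm //.
    apply: (@le_trans _ _ (t * (`|v| + 1))); first by rewrite ler_pM2l ?lerDl.
    by rewrite -ler_pdivlMr.
  have [D0|/set0P/negP/negPn/eqP D0] := pselect (D !=set0); last first.
    by exists t0; do !split => //; [exact: t0v|rewrite D0].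
  have [q /set_mem Dq qD] : exists2 q, q \in D & forall p, p \in D -> q.2 <= p.2.
    apply: compact_EVT_min => //; apply: continuous_subspaceT => p.
    exact: cvg_snd.
  have q0 : 0 < q.2.
    have [xq rq _] := DE _ Dq.
    rewrite lt_neqAle (p2 _ xq).1 andbT eq_sym; apply/eqP => /(p2_eq0 _ xq) E.
    by move: rq; rewrite E normr0; lra.
  exists (Num.min t0 (q.2 / 2)).
  have mgt0 : 0 < Num.min t0 (q.2 / 2) by rewrite lt_min t0_gt0 divr_gt0.
  do !split => //; first by apply: t0v => //; rewrite ge_min lexx.
  move=> p Dp; have := qD p (mem_set Dp).
  by apply: lt_le_trans; rewrite gt_min; apply/orP; right; lra.
have near p : D p -> `|t *: v - f p| < r.
  move=> Dp; have [xp _ pr] := DE _ Dp; have tp := tD _ Dp.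
  have p0 : 0 < p.2 by exact: lt_trans tp.
  (* Since [v] is [x] plus a multiple of [e], the norm of [p.2 *: v] is at least [p.2 * |x|]. *)
  have pv : p.2 *: v <> 0.
    have := xe p.2 (p.2 * s').
    rewrite -scalerA -scalerDr -vE => + v0; rewrite v0 normr0 gtr0_norm //.
    by apply/negP; rewrite -ltNge mulr_gt0.
  have := @strictly_convex_norm_lt _ _ r (t / p.2) (f p) (f p - p.2 *: v) scX.
  have -> : (1 - t / p.2) *: f p + (t / p.2) *: (f p - p.2 *: v) =
      f p - t *: v.
    rewrite scalerBr addrA -scalerDl subrK scale1r scalerA divfK //.
    by rewrite gt_eqF.
  move=> H; rewrite distrC; apply: H => //.
  - by move=> E; apply: pv; rewrite -(subKr (f p) (p.2 *: v)) -E subrr.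
  - rewrite /f addrK normrZ; apply: le_trans pr; exact: ev.
  - by rewrite divr_gt0.
  - by rewrite ltr_pdivrMr ?mul1r.
have [rho [rho_lt rhoD]] : exists rho, rho < r /\ forall p, D p ->
    `|t *: v - f p| <= rho.
  have [D0|/set0P/negP/negPn/eqP D0] := pselect (D !=set0); last first.
    by exists 0; rewrite D0.
  have [q /set_mem Dq qD] := compact_EVT_max D0 Dc
    (continuous_subspaceT (distc (t *: v))).
  exists `|t *: v - f q|; split; first exact: near.
  by move=> p Dp; exact/qD/mem_set.
exists (t *: v), (Num.max rho (3 / 4 * r)); split.
  by rewrite gt_max rho_lt /=; lra.
move=> a ar xa; rewrite le_max; have [ra|ra] := leP (r / 2) `|a|.
  by have [p Dp ->] := DP a ar xa ra; rewrite rhoD.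
apply/orP; right; apply: le_trans (ler_normB _ _) _; lra.
Qed.

Theorem theorem2p5 (R : realType) (X : finBanachType R) (A : set X) (c : X)
  (dimX : \dim {:X} = 2%N) (scX : strictly_convex X)
  (ntA : nontrivial A) (bA : bounded_set A)
  (cA : chebyshev_center A c) (Ac : A c) : CCNF A.
Proof.
move=> [{Ac}c' [{}cA [x _ [Ac xc]]]].
have dist_le z a : A a -> `|z - a| <= far_radius z A.
  move=> Aa; apply: ub_le_sup; last by exists a.
  have [M [_ /(_ (M + 1))]] := bA; rewrite ltrDl ltr01 => /(_ isT) MA.
  exists (`|z| + (M + 1)) => _ [b Ab <-].
  by apply: le_trans (ler_normB _ _) _; rewrite lerD2l; exact: MA.
have [a [Aa ac]] : exists a, A a /\ a <> c'.
  have [a [b [Aa Ab ab]]] := ntA.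
  have [E|ac] := pselect (a = c'); last by exists a.
  by exists b; split => // E'; apply: ab; rewrite E E'.
have r0 : 0 < far_radius c' A.
  apply: lt_le_trans (dist_le c' a Aa).
  by rewrite normr_gt0 subr_eq0 eq_sym; apply/eqP.
have xc0 : x - c' <> 0.
  move=> E; have := dist_le x a Aa; rewrite -xc E normr0 normr_le0 subr_eq0.
  by move/eqP => xa; apply: ac; rewrite -xa; exact: subr0_eq.
have [v [rho [rho_lt H]]] := lens_translate dimX scX xc0 r0.
(* For [b] in [A], the point [b - c'] lies in the lens of [x - c']: no point of [A] is farther from
   [x] than [c'] is. *)
have : far_radius (c' + v) A <= rho.
  apply: ge_sup; first by exists `|c' + v - c'|; exists c'.
  move=> _ [b Ab <-]; have -> : c' + v - b = v - (b - c').
    by rewrite opprB addrA [v + c']addrC.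
  apply: H; first by rewrite distrC dist_le.
  by rewrite opprB addrA subrK xc; exact: dist_le.
apply/negP; rewrite -ltNge; apply: (lt_le_trans rho_lt).
rewrite cA; apply: ge_inf; last by exists (c' + v).
(* Each radius dominates the distance to [c'], so 0 is a lower bound. *)
exists 0 => _ [z _ <-]; exact: le_trans (dist_le z c' Ac).
Qed.
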